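(* Let $N$, $M$ be chain-groups on $V$, $V'$ respectively. If $M$ is a minor of $N$, then $\lambda_M(T)\le\lambda_N(T\cup U)$ for all $T\subseteq V'$ and all $U\subseteq V\setminus V'$.
   Context: $\mathbb{F}$ is a field, $K=\mathbb{F}^2$ with bilinear form $\langle\,,\,\rangle_K$ equal to $b^+(\binom ab,\binom cd)=ad+bc$ or $b^-(\binom ab,\binom cd)=ad-bc$. A chain on $V$ to $K$ is a map $V\to K$; a chain-group is a subspace of $K^V$. For $T\subseteq V$: $f\cdot T$ is restriction; $N\times T=\{f\cdot T:f\in N, f(x)=0\ \forall x\notin T\}$; $N\setminus T=\{f\cdot(V\setminus T): f\in N,\ \langle f(x),\binom10\rangle_K=0\ \forall x\in T\}$; $N/T=\{f\cdot(V\setminus T): f\in N,\ \langle f(x),\binom01\rangle_K=0\ \forall x\in T\}$. A minor of $N$ is $N/X\setminus Y$ on $V\setminus(X\cup Y)$ for disjoint $X,Y\subseteq V$. $\lambda_N(U)=\frac12(\dim N-\dim(N\times(V\setminus U))-\dim(N\times U))$. *)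

(* Defs.v *)
From HB Require Import structures.
From mathcomp Require Import all_boot all_order all_algebra finmap.

Set Implicit Arguments.
Unset Strict Implicit.
Unset Printing Implicit Defensive.

Import GRing.Theory.
Local Open Scope ring_scope.
Local Open Scope fset_scope.

Definition colK (F : fieldType) (a b : F) : 'cV[F]_2 :=
  \col_(i < 2) (if i == 0 then a else b).

Definition bplus (F : fieldType) (u v : 'cV[F]_2) : F :=
  u 0 0 * v 1 0 + u 1 0 * v 0 0.

Definition bminus (F : fieldType) (u v : 'cV[F]_2) : F :=
  u 0 0 * v 1 0 - u 1 0 * v 0 0.

Variant formK_sign := FormPlus | FormMinus.

Definition formK (F : fieldType) (s : formK_sign) : 'cV[F]_2 -> 'cV[F]_2 -> F :=
  if s is FormPlus then @bplus F else @bminus F.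

(* Finite sets are drawn from an arbitrary choiceType E, so that V' \subset V,
   and unions of subsets of V' and V, make sense. *)
Section ChainGroups.
Variables (F : fieldType) (E : choiceType).
Implicit Types (V T U X Y : {fset E}) (s : formK_sign).

Definition chain V := {ffun V -> 'cV[F]_2}.
Definition chain_group V := {vspace chain V}.

(* Used only for T `<=` V; elements of T outside V get the value 0. *)
Definition restr V T (f : chain V) : chain T :=
  [ffun x : T => (if insub (val x) is Some y then f y else 0) : 'cV[F]_2].

Lemma restr_is_linear V T : linear (@restr V T).
Proof.
move=> a f g; apply/ffunP=> x; rewrite !ffunE.
by case: insubP => [y _ _|_]; rewrite ?ffunE ?scaler0 ?addr0.
Qed.

HB.instance Definition _ V T :=
  GRing.isLinear.Build F (chain V) (chain T) _ _ (@restr_is_linear V T).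

Lemma restrE V T (f : chain V) (x : T) (xV : val x \in V) :
  restr T f x = f [` xV].
Proof.
rewrite ffunE; case: insubP => [y _ yx|]; last by rewrite xV.
by congr (f _); apply: val_inj.
Qed.

Definition ev V (x : V) (f : chain V) : 'cV[F]_2 := f x.

Lemma ev_is_linear V (x : V) : linear (ev x).
Proof. by move=> a f g; rewrite /ev !ffunE. Qed.

HB.instance Definition _ V (x : V) :=
  GRing.isLinear.Build F (chain V) 'cV[F]_2 _ _ (ev_is_linear x).

Definition evform s V (x : V) (e : 'cV[F]_2) (f : chain V) : F^o :=
  formK s (f x) e.

Lemma evform_is_linear s V (x : V) e : linear (evform s x e).
Proof.
move=> a f g; rewrite /evform; case: s => /=; rewrite /bplus /bminus !ffunE !mxE.
  by rewrite /GRing.scale /= !mulrDl mulrDr !mulrA addrACA.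
by rewrite /GRing.scale /= !mulrDl mulrBr !mulrA opprD addrACA.
Qed.

HB.instance Definition _ s V (x : V) e :=
  GRing.isLinear.Build F (chain V) F^o _ _ (evform_is_linear s x e).

Definition cg_times V (N : chain_group V) T : chain_group T :=
  (linfun (@restr V T) @:
    (N :&: \bigcap_(x : V | val x \notin T) lker (linfun (ev x))))%VS.

Definition cg_orth s V (N : chain_group V) T (e : 'cV[F]_2) :
    chain_group (V `\` T) :=
  (linfun (@restr V (V `\` T)) @:
    (N :&: \bigcap_(x : V | val x \in T) lker (linfun (evform s x e))))%VS.

Definition cg_del s V (N : chain_group V) T : chain_group (V `\` T) :=
  cg_orth s N T (colK 1 0).

Definition cg_contr s V (N : chain_group V) T : chain_group (V `\` T) :=
  cg_orth s N T (colK 0 1).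

(* The equality of dependent pairs says that V' = V `\` X `\` Y and that M is
   N / X \ Y, up to this identification of the ground sets. *)
Definition is_minor s V' V (M : chain_group V') (N : chain_group V) : Prop :=
  exists X Y, [/\ X `<=` V, Y `<=` V, [disjoint X & Y] &
    existT chain_group V' M =
    existT chain_group (V `\` X `\` Y) (cg_del s (cg_contr s N X) Y)].

Definition lambda V (N : chain_group V) U : rat :=
  ((\dim N)%:R - (\dim (cg_times N (V `\` U)))%:R - (\dim (cg_times N U))%:R)
  / 2%:R.

Lemma memv_bigcap (vT : vectType F) (I : finType) (P : pred I)
    (W : I -> {vspace vT}) (v : vT) :
  reflect (forall i, P i -> v \in W i) (v \in (\bigcap_(i | P i) W i)%VS).
Proof.
rewrite memvE; apply: (iffP subv_bigcapP) => h i Pi.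
  by rewrite memvE; apply: h.
by rewrite -memvE; apply: h.
Qed.

Lemma mem_cg_times V (N : chain_group V) T (g : chain T) :
  g \in cg_times N T <->
  exists f : chain V,
    [/\ f \in N, forall x : V, val x \notin T -> f x = 0 & g = restr T f].
Proof.
split.
  case/memv_imgP=> f; rewrite memv_cap => /andP[fN /memv_bigcap fT] ->.
  exists f; split; rewrite ?lfunE //.
  by move=> x /fT; rewrite memv_ker lfunE => /eqP.
case=> f [fN f0 ->]; apply/memv_imgP; exists f; last by rewrite lfunE.
rewrite memv_cap fN; apply/memv_bigcap=> x /f0 fx.
by rewrite memv_ker lfunE; apply/eqP.
Qed.

Lemma mem_cg_orth s V (N : chain_group V) T e (g : chain (V `\` T)) :
  g \in cg_orth s N T e <->
  exists f : chain V,
    [/\ f \in N, forall x : V, val x \in T -> formK s (f x) e = 0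
      & g = restr (V `\` T) f].
Proof.
split.
  case/memv_imgP=> f; rewrite memv_cap => /andP[fN /memv_bigcap fT] ->.
  exists f; split; rewrite ?lfunE //.
  by move=> x /fT; rewrite memv_ker lfunE => /eqP.
case=> f [fN f0 ->]; apply/memv_imgP; exists f; last by rewrite lfunE.
rewrite memv_cap fN; apply/memv_bigcap=> x /f0 fx.
by rewrite memv_ker lfunE; apply/eqP.
Qed.

End ChainGroups.

(* Main.v *)
Require Import Defs.
From mathcomp Require Import all_boot all_order all_algebra finmap.
From mathcomp Require Import zify lra.

(** For a one-sided minor [M = N_L . (V \ Y)], where [N_L] is the space of
    chains in [N] whose values on [Y] are orthogonal to [e], put
    [S = V \ Y \ T] and let [A], [B] be the chains of [N_L] supported in
    [T `|` Y] and [S `|` Y]; both contain the kernel [A :&: B] of the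
    restriction, so [2 lambda_M(T) = dim N_L - dim (A + B)].  If [A'], [B'] are
    the chains of [N] supported in [T `|` U] and in its complement, then
    [2 lambda_N(T `|` U) = dim N - dim (A' + B')].  A sum [a' + b'] lying in
    [N_L] has both summands in [N_L], because their supports are disjoint;
    hence [N_L :&: (A' + B')] is contained in [A + B], and Grassmann's formula
    inside [N] gives the inequality.  A minor is reached in two such steps. *)

Set Implicit Arguments.
Unset Strict Implicit.
Unset Printing Implicit Defensive.

Import Order.POrderTheory GRing.Theory Num.Theory.
Local Open Scope ring_scope.
Local Open Scope fset_scope.

Section Connectivity.
Variables (F : fieldType) (E : choiceType).
Implicit Types (V T U Y : {fset E}).

(** [supported] and [orthogonal_on] are the intersections inside [cg_times] and [cg_orth], so the
    latter are, by conversion, images of [N :&: supported V T] and [N :&: orthogonal_on s V T e]. *)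
Definition supported V T : chain_group F V :=
  (\bigcap_(x : V | val x \notin T) lker (linfun (@ev F E V x)))%VS.

Definition orthogonal_on s V T (e : 'cV[F]_2) : chain_group F V :=
  (\bigcap_(x : V | val x \in T) lker (linfun (@evform F E s V x e)))%VS.

Lemma supportedP V T (f : chain F V) :
  reflect (forall x : V, val x \notin T -> f x = 0) (f \in supported V T).
Proof.
apply: (iffP (memv_bigcap _ _ _)) => h x /h.
  by rewrite memv_ker lfunE => /eqP.
by move=> fx; rewrite memv_ker lfunE; apply/eqP.
Qed.

Lemma orthogonal_onP s V T e (f : chain F V) :
  reflect (forall x : V, val x \in T -> formK s (f x) e = 0)
          (f \in orthogonal_on s V T e).
Proof.
apply: (iffP (memv_bigcap _ _ _)) => h x /h.
  by rewrite memv_ker lfunE => /eqP.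
by move=> fx; rewrite memv_ker lfunE; apply/eqP.
Qed.

Lemma formK0l s (e : 'cV[F]_2) : formK s 0 e = 0.
Proof. by case: s; rewrite /= /bplus /bminus !mxE !mul0r ?subr0 ?addr0. Qed.

Lemma restr_eq0P V T (TV : T `<=` V) (f : chain F V) :
  reflect (forall x : V, val x \in T -> f x = 0)
          (f \in lker (linfun (@restr F E V T))).
Proof.
rewrite memv_ker lfunE; apply: (iffP eqP) => /= h.
  move=> x xT; have /ffunP/(_ [` xT]) := h.
  rewrite (@restrE _ _ _ _ _ [` xT] (fsvalP x)) ffunE => <-.
  by congr (f _); apply: val_inj.
apply/ffunP=> x; rewrite (@restrE _ _ _ _ _ x (fsubsetP TV _ (fsvalP x))) ffunE.
by apply: h; apply: fsvalP.
Qed.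

(** Restriction to [T] is injective on chains supported in [T]. *)
Lemma dim_cg_times V (N : chain_group F V) T : T `<=` V ->
  \dim (cg_times N T) = \dim (N :&: supported V T).
Proof.
move=> TV; apply: limg_dim_eq; apply/eqP; rewrite -subv0; apply/subvP=> f.
rewrite !memv_cap memv0 => /andP[/andP[_ /supportedP f0] /(restr_eq0P TV) f1].
apply/eqP/ffunP=> x; rewrite ffunE.
by case: (boolP (val x \in T)) => [/f1|/f0].
Qed.

(** Rank-nullity for restriction to the complement of [Y]. Chains killed by it live on [Y], so the
    support condition [T]|[Y] does not shrink the kernel. *)
Lemma dim_cg_times_orth s V (N : chain_group F V) Y e T : T `<=` V `\` Y ->
  (\dim (cg_times (cg_orth s N Y e) T) +
   \dim (N :&: orthogonal_on s V Y e :&: lker (linfun (@restr F E V (V `\` Y))))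
   = \dim (N :&: orthogonal_on s V Y e :&: supported V (T `|` Y)))%N.
Proof.
move=> TV; rewrite dim_cg_times //.
set NL := (N :&: _)%VS; set r := linfun _.
have DV : V `\` Y `<=` V by apply: fsubsetDl.
have inD (x : V) : (val x \in V `\` Y) = (val x \notin Y).
  by rewrite in_fsetD (fsvalP x) andbT.
rewrite -(limg_ker_dim r (NL :&: supported V _)) addnC; congr (_ + _)%N; congr (\dim _).
  apply/vspaceP=> f; rewrite !memv_cap.
  case: (boolP (f \in lker r)) => [/(restr_eq0P DV) f0|]; rewrite ?andbF //.
  suff -> : f \in supported V (T `|` Y) by rewrite !andbT.
  apply/supportedP=> x; rewrite in_fsetU negb_or => /andP[_ xY].
  by apply: f0; rewrite inD.
apply/vspaceP=> g; apply/idP/idP.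
  rewrite memv_cap => /andP[/memv_imgP[f fN ->] /supportedP g0].
  apply: memv_img; rewrite memv_cap fN; apply/supportedP=> x.
  rewrite in_fsetU negb_or => /andP[xT xY].
  have xD : val x \in V `\` Y by rewrite inD.
  have := g0 [` xD] xT; rewrite lfunE /= (@restrE _ _ _ _ _ [` xD] (fsvalP x)).
  by move=> <-; congr (f _); apply: val_inj.
case/memv_imgP=> f + ->; rewrite [f \in _]memv_cap => /andP[fN /supportedP f0].
rewrite memv_cap memv_img //; apply/supportedP=> x xT.
have xV : val x \in V by apply: (fsubsetP DV); apply: fsvalP.
rewrite lfunE /= (@restrE _ _ _ _ _ x xV); apply: f0.
rewrite in_fsetU negb_or xT /=.
by have := fsvalP x; rewrite in_fsetD => /andP[].
Qed.

(** With [e] arbitrary, deletion and contraction are both instances. *)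
Lemma lambda_orth_le s V (N : chain_group F V) Y e T U :
  Y `<=` V -> T `<=` V `\` Y -> U `<=` Y ->
  lambda (cg_orth s N Y e) T <= lambda N (T `|` U).
Proof.
move=> YV TV UY.
have DV : V `\` Y `<=` V by apply: fsubsetDl.
have TUV : T `|` U `<=` V.
  by rewrite fsubUset (fsubset_trans TV DV) (fsubset_trans UY YV).
set S := V `\` Y `\` T.
have SV : S `<=` V `\` Y by apply: fsubsetDl.
have dT := @dim_cg_times_orth s V N Y e T TV.
have dS := @dim_cg_times_orth s V N Y e S SV.
have dA' := @dim_cg_times V N _ TUV.
have dB' := @dim_cg_times V N (V `\` (T `|` U)) (fsubsetDl _ _).
have := limg_ker_dim (linfun (@restr F E V (V `\` Y)))
          (N :&: orthogonal_on s V Y e).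
rewrite /lambda -/S.
rewrite -[X in (_ + X)%N = _]/(\dim (cg_orth s N Y e)).
move: dT dS dA' dB'.
set NL := (N :&: orthogonal_on s V Y e)%VS; set D := (NL :&: lker _)%VS.
set A := (NL :&: supported V (T `|` Y))%VS.
set B := (NL :&: supported V (S `|` Y))%VS.
set A' := (N :&: supported V (T `|` U))%VS.
set B' := (N :&: supported V (V `\` _))%VS.
(* [T]|[Y] and [S]|[Y] meet exactly in [Y]. *)
have ABD : (A :&: B = D)%VS.
  apply/vspaceP=> f; rewrite !memv_cap; case: (f \in N) => //=.
  case: (f \in orthogonal_on _ _ _ _) => //=; apply/andP/idP.
    case=> /supportedP f0 /supportedP f1; apply/(restr_eq0P DV) => x.
    rewrite in_fsetD => /andP[xY _].
    case: (boolP (val x \in T)) => xT.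
      by apply: f1; rewrite !inE xT (negPf xY).
    by apply: f0; rewrite !inE (negPf xT) (negPf xY).
  move/(restr_eq0P DV) => f0.
  by split; apply/supportedP=> x; rewrite in_fsetU negb_or => /andP[_ xY];
     apply: f0; rewrite in_fsetD xY (fsvalP x).
have AB0' : (A' :&: B' = 0)%VS.
  apply/eqP; rewrite -subv0; apply/subvP=> f; rewrite !memv_cap memv0.
  case/andP=> /andP[_ /supportedP f0] /andP[_ /supportedP f1].
  apply/eqP/ffunP=> x; rewrite ffunE.
  case: (boolP (val x \in T `|` U)) => [xTU|/f0//].
  by apply: f1; rewrite in_fsetD xTU.
have sub : (NL :&: (A' + B') <= A + B)%VS.
  apply/subvP=> f; rewrite !memv_cap => /andP[/andP[_ /orthogonal_onP fL]].
  case/memv_addP=> a; rewrite memv_cap => /andP[aN /supportedP a0].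
  case=> b; rewrite memv_cap => /andP[bN /supportedP b0] fE.
  (* At each point [a] and [b] equal either [f] or 0, so both inherit the orthogonality of [f] on
     [Y]. *)
  have aE (x : V) : val x \in T `|` U -> f x = a x.
    by move=> xTU; rewrite fE ffunE (b0 x) ?addr0 // in_fsetD xTU.
  have bE (x : V) : val x \notin T `|` U -> f x = b x.
    by move=> xTU; rewrite fE ffunE (a0 x) ?add0r.
  rewrite fE; apply: memv_add; rewrite !memv_cap ?aN ?bN /=; apply/andP; split.
  - apply/orthogonal_onP=> x xY; case: (boolP (val x \in T `|` U)) => xTU.
      by rewrite -aE //; apply: fL.
    by rewrite a0 // formK0l.
  - apply/supportedP=> x xTY; apply: a0; apply: contra xTY.
    by rewrite !in_fsetU => /orP[->//|/(fsubsetP UY) ->]; rewrite orbT.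
  - apply/orthogonal_onP=> x xY; case: (boolP (val x \in T `|` U)) => xTU.
      by rewrite b0 ?formK0l // in_fsetD xTU.
    by rewrite -bE //; apply: fL.
  - apply/supportedP=> x xSY; apply: b0; apply: contra xSY.
    by rewrite !inE (fsvalP x) negb_or !andbT => /andP[-> _]; case: (_ \in Y).
have subN : (NL + (A' + B') <= N)%VS.
  by rewrite !subv_add !capvSl.
(* In the resulting count [\dim D] cancels: it enters once through [\dim NL] and once, net, through
   [\dim (A + B)]. *)
have := dimv_sum_cap A B; have := dimv_sum_cap A' B'.
have := dimv_sum_cap NL (A' + B')%VS; have := dimvS sub; have := dimvS subN.
rewrite ABD AB0' dimv0 => h1 h2 h3 h4 h5 h6 h7 -> -> h8.
have : (\dim (cg_orth s N Y e) + \dim A' + \dim B' <=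
        \dim N + \dim (cg_times (cg_orth s N Y e) S)
          + \dim (cg_times (cg_orth s N Y e) T))%N.
  (* [lia] cannot identify atoms that differ by a canonical structure path. *)
  have arith u n i p nl q a' b' d a b tT tS m : (u <= n -> i <= p ->
    u + i = nl + q -> q + 0 = a' + b' -> p + d = a + b -> tT + d = a ->
    tS + d = b -> d + m = nl -> m + a' + b' <= n + tS + tT)%N by lia.
  exact: arith h1 h2 h3 h4 h5 h6 h7 h8.
rewrite -(ler_nat rat) !natrD => h; lra.
Qed.

End Connectivity.

Theorem theorem3p14 (F : fieldType) (s : formK_sign) (E : choiceType)
    (V V' : {fset E}) (N : chain_group F V) (M : chain_group F V') :
  is_minor s M N ->
  forall T U : {fset E}, T `<=` V' -> U `<=` V `\` V' ->
    lambda M T <= lambda N (T `|` U).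
Proof.
case=> X [Y [XV YV dXY eqM]] T U.
(* A predicate on pairs lets [eqM] rewrite the ground set and the chain-group together, without a
   cast. *)
pose P (p : {W : {fset E} & chain_group F W}) := T `<=` projT1 p ->
  U `<=` V `\` projT1 p -> lambda (projT2 p) T <= lambda N (T `|` U).
suff: P (existT _ V' M) by [].
rewrite eqM /P /= => TW /fsubsetP UW.
have YX : Y `<=` V `\` X.
  by rewrite fsubsetD YV fdisjoint_sym.
have TX : T `<=` V `\` X by apply: fsubset_trans TW (fsubsetDl _ _).
(* Deleting [Y] accounts for [U]&[Y], contracting [X] for [U]&[X]. *)
have UE : U = (U `&` Y) `|` (U `&` X).
  apply/fsetP=> x; rewrite !inE -andb_orr; case: (boolP (x \in U)) => // /UW.
  rewrite !inE; case: (x \in V); rewrite ?andbF // !andbT.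
  by case: (x \in Y); case: (x \in X).
rewrite {1}UE fsetUA.
apply: le_trans (lambda_orth_le _ _ _ YX TW (fsubsetIr U Y)) _.
apply: lambda_orth_le => //; last exact: fsubsetIr.
by rewrite fsubUset TX (fsubset_trans (fsubsetIr _ _) YX).
Qed.
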